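(* Let $n\ge 3$ and $m\ge 2$ be integers and consider the cycle-based self-similar graphs $G^{(i)}=G^{(i,m,n)}$ defined in the context. For $k\ge 0$ let $|V^{(k)}|$ denote the number of vertices of $G^{(k-1)}$, where $G^{(-1)}$ is a single vertex (so $|V^{(0)}|=1$, $|V^{(1)}|=n$). Then for every $i\ge 0$ the number of spanning trees of $G^{(i)}$ is $$\tau\big(G^{(i,m,n)}\big)=n^{\sum_{j=0}^{i}|V^{(j)}|}\; m^{\sum_{j=0}^{i}(i-j)|V^{(j)}|}.$$
   Context: The edge-path transformation replaces every edge of a graph by a path of length $m$ (inserting $m-1$ new internal vertices on each edge). The cycle-based model: $G^{(0)}=C_n$, and for $i\ge 0$, $G^{(i+1)}$ is obtained from $G^{(i)}$ by first applying the edge-path transformation, and then, for every vertex $v$ of $G^{(i)}$ (i.e. every vertex present before the subdivision), attaching a new copy of $C_n$ by identifying $v$ with one vertex of that copy. $\tau(G)$ denotes the number of spanning trees of $G$. *)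

(* Defs.v *)
From mathcomp Require Import all_boot.

Set Implicit Arguments.
Unset Strict Implicit.
Unset Printing Implicit Defensive.

(* Finite undirected graphs. The order of the two ends of an edge carries no
   meaning: all the notions below treat both traversals of an edge alike. *)
Record graph := Graph {
  vertex : finType;
  edge : finType;
  ends : edge -> vertex * vertex
}.

Section SpanningTrees.
Variable G : graph.

(* An edge together with a direction of traversal. *)
Definition dart : finType := (edge G * bool)%type.
Definition dsrc (d : dart) : vertex G :=
  if d.2 then (ends d.1).2 else (ends d.1).1.
Definition dtgt (d : dart) : vertex G :=
  if d.2 then (ends d.1).1 else (ends d.1).2.

Definition adj (S : {set edge G}) : rel (vertex G) :=
  [rel u v | [exists d : dart, [&& d.1 \in S, dsrc d == u & dtgt d == v]]].

Definition connected (S : {set edge G}) : bool :=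
  [forall u, forall v, connect (adj S) u v].

(* A loop is a cycle of length 1 and two parallel edges form a cycle of
   length 2. *)
Definition is_cycle (S : {set edge G}) (c : seq dart) : bool :=
  [&& c != [::],
      all [pred d : dart | d.1 \in S] c,
      cycle [rel d d' : dart | dtgt d == dsrc d'] c,
      uniq [seq d.1 | d <- c] &
      uniq [seq dsrc d | d <- c]].

(* The length bound is harmless, as the edges of a cycle are distinct. *)
Definition acyclic (S : {set edge G}) : bool :=
  ~~ [exists c : {bseq #|edge G| of dart}, is_cycle S c].

Lemma acyclicP (S : {set edge G}) :
  reflect (forall c, ~~ is_cycle S c) (acyclic S).
Proof.
apply: (iffP existsPn) => [acS c | acS c]; last exact: acS.
apply/negP => cycc; have /and5P[_ _ _ /card_uniqP Uc _] := cycc.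
have szc : size c <= #|edge G| by rewrite -(size_map fst) -Uc max_card.
by have := acS (Bseq szc); rewrite /= cycc.
Qed.

Definition spanning_tree (S : {set edge G}) : bool :=
  connected S && acyclic S.

Definition tau : nat := #|[set S | spanning_tree S]|.

End SpanningTrees.

Definition single_vertex : graph := @Graph unit void (of_void _).

Definition cycle_graph (n : nat) : graph :=
  @Graph 'I_n 'I_n (fun k => (k, ordS k)).

Section EdgePath.
Variables (m : nat) (G : graph).

Definition ep_vertex : finType := (vertex G + edge G * 'I_m.-1)%type.

(* The vertex at position k on the path of length m replacing e: position 0 is
   the first end of e, position m the second one, and position j.+1, for
   j < m.-1, is the new internal vertex (e, j). *)
Definition ep_pos (e : edge G) (k : nat) : ep_vertex :=
  if k is k'.+1 then
    if insub k' is Some j then inr (e, j) else inl (ends e).2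
  else inl (ends e).1.

Definition edge_path : graph :=
  @Graph ep_vertex (edge G * 'I_m)%type
    (fun x => (ep_pos x.1 x.2, ep_pos x.1 x.2.+1)).

End EdgePath.

Section AttachCycles.
Variables (n : nat) (H : graph) (W : finType) (f : W -> vertex H).

(* One copy of the n-cycle for each w : W, whose vertex 0 is identified with
   f w; the other vertices of the copies are new. *)
Definition ac_vertex : finType :=
  (vertex H + W * {k : 'I_n | 0 < k})%type.

Definition ac_glue (w : W) (k : vertex (cycle_graph n)) : ac_vertex :=
  if insub k is Some k' then inr (w, k') else inl (f w).

Definition ac_ends (x : edge H + W * edge (cycle_graph n)) :
    ac_vertex * ac_vertex :=
  match x with
  | inl e => (inl (ends e).1, inl (ends e).2)
  | inr (w, e) => (ac_glue w (ends e).1, ac_glue w (ends e).2)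
  end.

Definition attach_cycles : graph :=
  @Graph ac_vertex (edge H + W * edge (cycle_graph n))%type ac_ends.

End AttachCycles.

Definition step (m n : nat) (G : graph) : graph :=
  @attach_cycles n (edge_path m G) (vertex G) inl.

Fixpoint ssgraph (i m n : nat) : graph :=
  if i is i'.+1 then step m n (ssgraph i' m n) else cycle_graph n.

(* The order |V^(k)| of G^(k-1), where G^(-1) is a single vertex. *)
Definition nbV (m n k : nat) : nat :=
  #|vertex (if k is k'.+1 then ssgraph k' m n else single_vertex)|.

(* Main.v *)
(** Spanning trees are the minimal connected edge sets, and an edge set is
    connected iff every two-colouring of the vertices that is constant along its
    edges is constant. Hence the spanning trees of a cycle are the complements
    of the single edges; those of a graph with attached cycles are the
    independent choices of a spanning tree of the graph and of each cycle; and
    those of a subdivided graph are obtained from a spanning tree [F] of the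
    original graph by deleting one of the [m] pieces of each edge outside [F].
    All spanning trees of the i-th graph omit the same number [b_i] of edges,
    where [b_0 = 1] and [b_(i+1) = b_i + |V(G^(i))|], and
    [tau_(i+1) = n ^ |V(G^(i))| * m ^ b_i * tau_i]. *)
Require Import Defs.
From mathcomp Require Import all_boot zify.

Set Implicit Arguments.
Unset Strict Implicit.
Unset Printing Implicit Defensive.

(** * Connectivity through two-colourings; spanning trees as minimal connected edge sets *)

Section MinimalConnected.
Variable G : graph.
Implicit Types (S : {set edge G}) (c : vertex G -> bool).

Definition constant_along S c :=
  forall e, e \in S -> c (ends e).1 = c (ends e).2.

Lemma constant_along_dart S c (d : dart G) :
  constant_along S c -> d.1 \in S -> c (dsrc d) = c (dtgt d).
Proof. by case: d => e [] cS /= /cS; rewrite /dsrc /dtgt /= => ->. Qed.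

Lemma adj_sym S : symmetric (adj S).
Proof.
suff adjW u v : adj S u v -> adj S v u by move=> u v; apply/idP/idP; apply: adjW.
case/existsP=> -[e b] /and3P[eS su tv]; apply/existsP; exists (e, ~~ b).
by rewrite /=; case: b eS su tv => /= ->; rewrite /dsrc /dtgt /= => -> ->.
Qed.

(** Adjacency preserves a colouring that is constant along [S]. Conversely, the set of vertices
    reachable from [u] is itself such a colouring. *)
Lemma connectedP S :
  reflect (forall c, constant_along S c -> forall u v, c u = c v)
          (connected S).
Proof.
apply: (iffP forallP) => [conS c cS u v | conS u].
  have /forallP/(_ v) uv := conS u.
  have clS : closed (adj S) c.
    move=> x y /existsP[d /and3P[dS /eqP<- /eqP<-]].
    exact: (constant_along_dart cS dS).
  exact: (closed_connect clS uv).
apply/forallP => v; rewrite -(conS (connect (adj S) u) _ u v) ?connect0 //.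
move=> e eS; apply: same_connect_r; first exact/sym_connect_sym/adj_sym.
by apply: connect1; apply/existsP; exists (e, false); rewrite /= eS /dsrc /dtgt !eqxx.
Qed.

(** Lifts a simple vertex path to darts. The clause on [d0] allows any dart ending at [x] to be put
    in front, which is how a path is later closed into a cycle. *)
Lemma simple_path_darts S x p :
  path (adj S) x p -> uniq (x :: p) ->
  exists ds : seq (dart G),
    [/\ all [pred d : dart G | d.1 \in S] ds,
        forall d0, path [rel d d' : dart G | dtgt d == dsrc d'] d0 ds
                   = (ds == [::]) || (dtgt d0 == x),
        [seq dsrc d | d <- ds] = belast x p,
        [seq dtgt d | d <- ds] = p &
        uniq [seq d.1 | d <- ds]].
Proof.
elim: p x => [|y p IHp] x /=; first by exists [::].
case/andP=> /existsP[d /and3P[dS /eqP dx /eqP dy]] /IHp IH /andP[xp up].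
have [ds [dsS dsp dss dst dsu]] := IH up.
exists (d :: ds); split=> /=; rewrite ?dS ?dx ?dy ?dss ?dst //.
  by move=> d' /=; rewrite dsp dy eqxx orbT andbT.
rewrite dsu andbT; apply/negP => /mapP[d' d'ds ed'].
have sd' : dsrc d' \in y :: p.
  by apply: mem_belast; rewrite -dss map_f.
have td' : dtgt d' \in y :: p by rewrite inE -dst map_f ?orbT.
(* If [d'] reuses the edge of [d], then [x] is an end of [d']; but both ends of [d'] lie on
   [y :: p], which avoids [x]. *)
have : (x == dsrc d') || (x == dtgt d').
  by rewrite -dx /dsrc /dtgt ed'; case: (d.2); case: (d'.2); rewrite eqxx ?orbT.
by case/orP=> /eqP xd'; rewrite xd' (sd', td') in xp.
Qed.

(** An edge on a cycle can be removed without disconnecting. Conversely, if [S :\ e] is connected, a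
    simple path in it between the ends of [e] closes up with [e] to a cycle. *)
Lemma spanning_treeP S :
  reflect (connected S /\ forall e, e \in S -> ~~ connected (S :\ e))
          (spanning_tree S).
Proof.
apply: (iffP andP) => -[conS]; last first.
  move=> minS; split=> //; apply/acyclicP => -[|d c] //.
  apply/negP => /and5P[_ /= /andP[dS cS] + /andP[dc _] _].
  rewrite rcons_path => /andP[dcp cd]; case/negP: (minS _ dS).
  apply/connectedP => k kS; have kS' : constant_along S k; last first.
    exact: (connectedP _ conS).
  (* The rest of the cycle leads from the target of [d] back to its source without using the edge of
     [d]. *)
  have kd : k (dtgt d) = k (dsrc d).
    rewrite -(eqP cd); move: (d.1) dc kS => e0 dc kS.
    elim: c (d) {cd} dcp cS dc => //= d1 c IHc d0.
    case/andP=> /eqP-> d1c /andP[d1S cS]; rewrite inE negb_or => /andP[dd1 dc].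
    rewrite (constant_along_dart kS); first exact: IHc.
    by rewrite !inE d1S eq_sym dd1.
  move=> e eS; have [ed | ed] := eqVneq e d.1; last by apply: kS; rewrite !inE ed.
  by rewrite ed; move: kd; rewrite /dsrc /dtgt; case: (d.2).
move=> /acyclicP acS; split=> // e eS; apply/negP => /forallP/(_ (ends e).2).
move/forallP/(_ (ends e).1)/connectP => [p0 /shortenP[p pS up _] {p0} lastp].
have [ds [dsS dsp dss dst dsu]] := simple_path_darts pS up.
case/negP: (acS ((e, false) :: ds)); apply/and5P; split=> //.
- rewrite /= eS /=; apply: sub_all dsS => d /=.
  by rewrite inE => /andP[].
- rewrite /= rcons_path dsp [dtgt (e, false)]/= eqxx orbT /=.
  by rewrite -(last_map (@dtgt G)) dst /dsrc /= /dtgt /= -lastp.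
- rewrite /= dsu andbT; apply/negP => /mapP[d dds ed].
  by have /= := allP dsS d dds; rewrite -ed !inE eqxx.
- by rewrite map_cons dss /dsrc /= lastp -rcons_uniq -lastI.
Qed.

End MinimalConnected.

Lemma line_constant (c : nat -> bool) a b :
  (forall i, a <= i < b -> c i = c i.+1) ->
  forall i, a <= i <= b -> c i = c a.
Proof.
move=> cS; elim=> [|i IHi] iab; first by congr c; lia.
have [ai | ] := ltnP a i.+1; first by rewrite -cS ?IHi //; lia.
by move=> ?; congr c; lia.
Qed.

(** * Spanning trees of a cycle *)

Section Cycle.
Variable n : nat.
Hypothesis n_gt0 : 0 < n.
Implicit Types (S : {set 'I_n}).

Lemma cycle_connectedP S :
  reflect (forall k k', k \notin S -> k' \notin S -> k = k')
          (connected (S : {set edge (cycle_graph n)})).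
Proof.
apply: (iffP (connectedP _)) => [conS a b aS bS | uS c cS u v].
  wlog ltab : a b aS bS / a < b.
    move=> W; case: (ltngtP a b) => [/W|/W|/val_inj//]; first exact.
    by move=> W'; apply/esym/W'.
  (* The arc from [a.+1] to [b] is one of the two pieces left by the missing edges [a] and [b]; its
     indicator changes only across these. *)
  have := conS (fun i : 'I_n => a < i <= b) _ a b.
  rewrite ltnn ltab leqnn => cab; suff: false = true by [].
  apply: cab => j jS /=; have ja : j != a :> nat by apply: contraNneq aS => /val_inj<-.
  have jb : j != b :> nat by apply: contraNneq bS => /val_inj<-.
  have [jn | jn] := ltnP j.+1 n; first by rewrite modn_small //; lia.
  have -> : j.+1 = n by have := ltn_ord j; lia.
  by rewrite modnn; have := ltn_ord b; lia.
(* [k] is the only edge that may be missing; if none is, edge 0 serves as well. *)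
pose o := Ordinal n_gt0; have [k kS] : exists k, forall j, j != k -> j \in S.
  have [k kS | S_full] := pickP [pred k | k \notin S].
    exists k => j; apply: contraNT => jS; exact/eqP/uS.
  by exists o => j _; have := S_full j; move/negbFE.
pose c' i := c (insubd o i).
have c'E (i : 'I_n) : c i = c' i by rewrite /c' valKd.
have c'S i : i.+1 < n -> i != k -> c' i = c' i.+1.
  move=> lti ik; have := cS (insubd o i); rewrite {1}/c' => -> /=; last first.
    apply: kS; apply: contraNneq ik => <-; by rewrite val_insubd ltnW.
  rewrite /c'; congr c; apply: val_inj.
  by rewrite /= !val_insubd lti ltnW // modn_small.
have lo i : i <= k -> c' i = c' 0.
  move=> ik; apply: (@line_constant c' 0 k) => // j jk.
  by apply: c'S; have := ltn_ord k; lia.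
(* Vertices beyond edge [k] reach vertex 0 the other way round, through [n.-1] and the wrap-around
   edge, which differs from [k] because [k < n.-1] here. *)
have hi i : k < i < n -> c' i = c' 0.
  move=> ik; have -> : c' i = c' k.+1.
    by apply: (@line_constant c' k.+1 n.-1) => [j jk|]; [apply: c'S|]; lia.
  have <- : c' n.-1 = c' k.+1.
    by apply: (@line_constant c' k.+1 n.-1) => [j jk|]; [apply: c'S|]; lia.
  have ln : n.-1 < n by lia.
  have := cS (Ordinal ln); rewrite /= !c'E /=.
  rewrite prednK // modnn; apply; apply: kS; apply/eqP => /(congr1 val) /=; lia.
suff all0 (w : 'I_n) : c w = c' 0 by rewrite !all0.
by rewrite c'E; have [/lo // | kw] := leqP w k; apply: hi; rewrite kw ltn_ord.
Qed.

(** A connected set misses at most one edge, and the full set is not minimal: it stays connected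
    without edge 0. *)
Lemma cycle_spanning_treeP S :
  reflect (exists k, S = ~: [set k])
          (spanning_tree (S : {set edge (cycle_graph n)})).
Proof.
apply: (iffP (spanning_treeP _)) => [[/cycle_connectedP uS minS] | [k ->]].
  have [k kS | S_full] := pickP [pred k | k \notin S].
    exists k; apply/setP => j; rewrite !inE; apply/idP/idP => [jS | ].
      by apply: contraNneq kS => <-.
    by apply: contraNT => jS; apply/eqP/uS.
  case/negP: (minS (Ordinal n_gt0) (negbFE (S_full _))).
  apply/cycle_connectedP => i j; rewrite !inE !negb_and !negbK.
  by have /negbFE-> := S_full i; have /negbFE-> := S_full j;
    rewrite !orbF => /eqP-> /eqP->.
split=> [|e].
  by apply/cycle_connectedP => i j; rewrite !inE !negbK => /eqP-> /eqP->.
rewrite !inE => ek; apply: contraNN ek => /cycle_connectedP/(_ e k)->;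
  by rewrite ?inE ?eqxx ?andbF.
Qed.

Lemma card_cycle_spanning_tree S :
  spanning_tree (S : {set edge (cycle_graph n)}) -> #|~: S| = 1.
Proof. by case/cycle_spanning_treeP=> k ->; rewrite setCK cards1. Qed.

Lemma tau_cycle : tau (cycle_graph n) = n.
Proof.
have -> : tau (cycle_graph n) = #|[set ~: [set k] | k : 'I_n]|.
  apply: eq_card => S; rewrite inE; apply/cycle_spanning_treeP/imsetP.
    by case=> k ->; exists k.
  by case=> k _ ->; exists k.
by rewrite card_imset ?card_ord // => k k' /setC_inj/set1_inj.
Qed.

End Cycle.

(** * Spanning trees of a graph with attached cycles *)

Section AttachCycles.
Variables (n : nat) (H : graph) (W : finType) (f : W -> vertex H).
Hypothesis n_gt0 : 0 < n.
Let A := attach_cycles n f.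
Implicit Types (S : {set edge A}) (T : {set edge H}) (w : W).

Definition ac_base S : {set edge H} := [set e | inl e \in S].
Definition ac_copy S w : {set edge (cycle_graph n)} := [set k | inr (w, k) \in S].

(** Colourings of the base and of any single copy extend to the whole graph. Conversely, a colouring
    constant on the base and on each copy is constant, as every copy meets the base. *)
Lemma ac_connectedP S :
  reflect (connected (ac_base S) /\ forall w, connected (ac_copy S w))
          (connected S).
Proof.
pose o := Ordinal n_gt0.
have glue0 w : ac_glue f w o = inl (f w) by rewrite /ac_glue insubN.
have glueS w (k : {k : 'I_n | 0 < k}) : ac_glue f w (val k) = inr (w, k).
  by rewrite /ac_glue valK.
apply: (iffP (connectedP _)) => [conS | [/connectedP conH conC] c cS].
  split=> [|w].
    apply/connectedP => c cH u v.
    pose c' (x : vertex A) := match x with inl u => c u | inr (w, _) => c (f w) end.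
    apply: (conS c' _ (inl u) (inl v)) => -[e | [w k]] eS.
      by apply: cH; rewrite inE.
    have c'E k' : c' (ac_glue f w k') = c (f w) by rewrite /ac_glue; case: insub.
    by rewrite /= !c'E.
  apply/connectedP => c cC u v.
  (* Everything outside copy [w] takes the colour of vertex 0 of that copy, the only vertex it
     shares with the base. *)
  pose c' (x : vertex A) :=
    if x is inr (w', k) then if w' == w then c (val k) else c o else c o.
  have c'E w' k : c' (ac_glue f w' k) = if w' == w then c k else c o.
    rewrite /ac_glue; case: insubP => [k' _ <- // | k0].
    by rewrite /= (_ : k = o) ?if_same //; apply: val_inj; move: k0 => /=; lia.
  have := conS c' _ (ac_glue f w u) (ac_glue f w v); rewrite !c'E eqxx; apply.
  move=> [e //| [w' k]] eS; rewrite /= !c'E; have [ww|//] := eqVneq.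
  by apply: cC; rewrite inE -ww.
have cH u v : c (inl u) = c (inl v).
  by apply: (conH (fun u => c (inl u))) => e; rewrite inE => /cS.
have cG x : exists u, c x = c (inl u).
  case: x => [u | [w k]]; first by exists u.
  exists (f w); rewrite -glue0 -glueS.
  have /connectedP conw := conC w.
  by apply: (conw (fun k => c (ac_glue f w k))) => k'; rewrite inE => /cS.
by move=> x y; have [u ->] := cG x; have [v ->] := cG y.
Qed.

(** Deleting an edge affects only the base or one copy, so minimality, like connectivity, is tested
    separately on each of them. *)
Lemma ac_spanning_treeP S :
  reflect (spanning_tree (ac_base S) /\ forall w, spanning_tree (ac_copy S w))
          (spanning_tree S).
Proof.
apply: (iffP (spanning_treeP _)).
  case=> /ac_connectedP[conH conC] minS; split=> [|w].
    apply/spanning_treeP; split=> // e; rewrite inE => /minS; apply: contraNN => conHe.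
    apply/ac_connectedP; split=> [|w].
      by congr connected: conHe; apply/setP => e'; rewrite !inE.
    by have := conC w; congr connected; apply/setP => k; rewrite !inE.
  apply/spanning_treeP; split=> // k; rewrite inE => /minS; apply: contraNN => conCk.
  apply/ac_connectedP; split=> [|w'].
    by congr connected: conH; apply/setP => e'; rewrite !inE.
  have [-> | ww] := eqVneq w' w.
    congr connected: conCk; apply/setP => k'; rewrite !inE.
    by rewrite -[inr _ == _]/((w, k') == (w, k)) xpair_eqE eqxx.
  have := conC w'; congr connected; apply/setP => k'; rewrite !inE.
  by rewrite -[inr _ == _]/((w', k') == (w, k)) xpair_eqE (negbTE ww).
case=> /spanning_treeP[conH minH] treeC; split=> [|[e | [w k]] eS].
- by apply/ac_connectedP; split=> // w; have /spanning_treeP[] := treeC w.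
- have eH : e \in ac_base S by rewrite inE.
  apply/negP => /ac_connectedP[conHe _]; case/negP: (minH e eH).
  by congr connected: conHe; apply/setP => e'; rewrite !inE.
have /spanning_treeP[_ minC] := treeC w.
have kC : k \in ac_copy S w by rewrite inE.
apply/negP => /ac_connectedP[_ /(_ w) conCk]; case/negP: (minC k kC).
congr connected: conCk; apply/setP => k'; rewrite !inE.
by rewrite -[inr _ == _]/((w, k') == (w, k)) xpair_eqE eqxx.
Qed.

(** Reassembles an edge set from its traces on the base and the copies; a finite function holds the
    latter so that the families can be counted. *)
Definition ac_join (Tg : {set edge H} * {ffun W -> {set edge (cycle_graph n)}})
    : {set edge A} :=
  [set x : edge A | match x with inl e => e \in Tg.1 | inr (w, k) => k \in Tg.2 w end].

Lemma ac_base_join Tg : ac_base (ac_join Tg) = Tg.1.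
Proof. by apply/setP => e; rewrite !inE. Qed.

Lemma ac_copy_join Tg w : ac_copy (ac_join Tg) w = Tg.2 w.
Proof. by apply/setP => e; rewrite !inE. Qed.

Lemma ac_joinK S : ac_join (ac_base S, [ffun w => ac_copy S w]) = S.
Proof. by apply/setP => -[e | [w k]]; rewrite !inE //= ffunE inE. Qed.

Lemma ac_join_inj : injective ac_join.
Proof.
move=> [T g] [T' g'] eqTg; congr pair.
  by have := ac_base_join (T, g); rewrite eqTg ac_base_join.
by apply/ffunP => w; have := ac_copy_join (T, g) w; rewrite eqTg ac_copy_join.
Qed.

Lemma tau_attach_cycles : tau A = tau H * n ^ #|W|.
Proof.
pose trees G := [set T : {set edge G} | spanning_tree T].
pose D := [set Tg : {set edge H} * {ffun W -> {set edge (cycle_graph n)}} |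
           (Tg.1 \in trees H) && (Tg.2 \in ffun_on (trees (cycle_graph n)))].
have -> : tau A = #|ac_join @: D|.
  apply: eq_card => S; rewrite inE; apply/ac_spanning_treeP/imsetP.
    case=> treeH treeC; exists (ac_base S, [ffun w => ac_copy S w]); last first.
      by rewrite ac_joinK.
    by rewrite !inE treeH; apply/ffun_onP => w; rewrite ffunE inE.
  case=> Tg; rewrite !inE => /andP[tree1 /ffun_onP tree2] ->.
  by rewrite ac_base_join; split=> // w;
    rewrite ac_copy_join; have := tree2 w; rewrite inE.
rewrite (card_imset _ ac_join_inj).
have -> : D = setX (trees H) [set g in ffun_on (trees (cycle_graph n))].
  by apply/setP => Tg; rewrite !inE.
rewrite cardsX -[#|trees H|]/(tau H); congr (_ * _).
by rewrite cardsE card_ffun_on; congr (_ ^ _); apply: tau_cycle.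
Qed.

(** Each attached cycle omits exactly one edge. The common number of omitted edges is the exponent
    of [m] at the next subdivision. *)
Lemma card_attach_cycles_spanning_tree b :
  (forall T, spanning_tree T -> #|~: T| = b) ->
  forall S, spanning_tree S -> #|~: S| = b + #|W|.
Proof.
move=> bH S /ac_spanning_treeP[/bH <- treeC].
rewrite -!sum1_card big_sumType /=; congr (_ + _).
  by apply: eq_bigl => e; rewrite !inE.
transitivity (\sum_w \sum_(k in ~: ac_copy S w) 1).
  by rewrite pair_big_dep /=; apply: eq_bigl => -[w k]; rewrite !inE.
by apply: eq_bigr => w _; rewrite sum1_card; apply: card_cycle_spanning_tree.
Qed.

End AttachCycles.

(** * Spanning trees of a subdivided graph *)

Section EdgePath.
Variables (m : nat) (G : graph).
Hypothesis m_gt0 : 0 < m.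
Let P := edge_path m G.
Implicit Types (S : {set edge P}) (F : {set edge G}) (e : edge G).

Definition ep_full S : {set edge G} := [set e | [forall k, (e, k) \in S]].

Lemma ep_pos_end e : ep_pos m e m = inl (ends e).2.
Proof. by case: m m_gt0 => // m' _; rewrite /ep_pos insubN //= ltnn. Qed.

Lemma ep_pos_inner e (j : 'I_m.-1) : ep_pos m e j.+1 = inr (e, j).
Proof. by rewrite /ep_pos valK. Qed.

Lemma ep_pos_ind (Q : nat -> ep_vertex m G -> Prop) e :
  Q 0 (inl (ends e).1) -> Q m (inl (ends e).2) ->
  (forall j : 'I_m.-1, Q j.+1 (inr (e, j))) ->
  forall k, k <= m -> Q k (ep_pos m e k).
Proof.
move=> Q0 Qm Qj [|k] km //=; case: insubP => [j _ <- | /= mk]; first exact: Qj.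
by have -> : k.+1 = m by lia.
Qed.

(** Two missing pieces of one path cut off the inner vertices between them. With at most one
    missing, every inner vertex still hangs on an end of its path, and only intact paths link their
    two ends. *)
Lemma ep_connectedP S :
  reflect ((forall e k k', (e, k) \notin S -> (e, k') \notin S -> k = k') /\
           connected (ep_full S))
          (connected S).
Proof.
apply: (iffP (connectedP _)) => [conS | [uS /connectedP conF] c cS].
  have uS e a b : (e, a) \notin S -> (e, b) \notin S -> a = b.
    move=> aS bS; wlog ltab : a b aS bS / a < b.
      move=> W; case: (ltngtP a b) => [/W|/W|/val_inj//]; first exact.
      by move=> W'; apply/esym/W'.
    (* Marks the positions from [a.+1] to [b] on the path of [e]; [inr (e, j)] sits at position
       [j.+1]. As [b < m], no original vertex is marked. *)
    pose c (x : vertex P) :=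
      if x is inr (e', j) then (e' == e) && (a < j.+1 <= b) else false.
    have cE e' k : k <= m -> c (ep_pos m e' k) = (e' == e) && (a < k <= b).
      apply: (@ep_pos_ind (fun k x => c x = (e' == e) && (a < k <= b))) => //=.
        by rewrite andbF.
      by rewrite andbC; have := ltn_ord b; lia.
    have cS : constant_along S c.
      move=> [e' k] kS.
      rewrite [LHS](cE e' k (ltnW (ltn_ord k))) [RHS](cE e' k.+1 (ltn_ord k)).
      have [ee /=|//] := eqVneq e' e.
      have ka : k != a :> nat by apply: contraNneq aS => /val_inj<-; rewrite -ee.
      have kb : k != b :> nat by apply: contraNneq bS => /val_inj<-; rewrite -ee.
      by lia.
    have := conS c cS (ep_pos m e b) (ep_pos m e a).
    by rewrite !cE ?(ltnW (ltn_ord _)) // eqxx ltab leqnn ltnn.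
  split=> //; apply/connectedP => c cF u v.
  (* The colour along a path switches at its missing piece. The default 0 is harmless: an intact [e]
     lies in [ep_full S], so its ends have the same colour. *)
  pose mis e : nat := if [pick k | (e, k) \notin S] is Some k then k else 0.
  pose c' (x : vertex P) :=
    match x with
    | inl u => c u
    | inr (e, j) => if j.+1 <= mis e then c (ends e).1 else c (ends e).2
    end.
  have mis_lt e : mis e < m by rewrite /mis; case: pickP.
  have c'E e k : k <= m ->
      c' (ep_pos m e k) = if k <= mis e then c (ends e).1 else c (ends e).2.
    apply: (@ep_pos_ind
      (fun k x => c' x = if k <= mis e then c (ends e).1 else c (ends e).2)) => //.
    by rewrite leqNgt mis_lt.
  apply: (conS c' _ (inl u) (inl v)) => -[e k] kS.
  rewrite [LHS](c'E e k (ltnW (ltn_ord k))) [RHS](c'E e k.+1 (ltn_ord k)).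
  case: (ltngtP k (mis e)) => // kmis; apply: cF; rewrite inE; apply/forallP => k'.
  move: kmis; rewrite /mis; case: pickP => [k'' k''S /val_inj kk | allS _].
    by rewrite kk (negbTE k''S) in kS.
  exact: negbFE (allS k').
pose d e k := c (ep_pos m e k).
have dS e (k : 'I_m) : (e, k) \in S -> d e k = d e k.+1 by move/cS.
have cV u v : c (inl u) = c (inl v).
  apply: (conF (fun u => c (inl u))) => e; rewrite inE => /forallP eS.
  rewrite -[LHS]/(d e 0) -(ep_pos_end e) -[RHS]/(d e m); apply/esym.
  apply: (@line_constant (d e) 0 m) => [k km|]; last by rewrite leqnn.
  exact: (dS e (Ordinal km)).
have cG x : exists u, c x = c (inl u).
  case: x => [u | [e j]]; first by exists u.
  rewrite -ep_pos_inner -[c _]/(d e j.+1).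
  have jm : j.+1 <= m by have := ltn_ord j; lia.
  have [k kS | ] := pickP [pred k | (e, k) \notin S]; last first.
    move=> allS; exists (ends e).1; rewrite -[RHS]/(d e 0).
    apply: (@line_constant (d e) 0 m) => // k km.
    exact: (dS e (Ordinal km) (negbFE (allS _))).
  have dS' i : i < m -> i != k -> d e i = d e i.+1.
    move=> im ik; apply: (dS e (Ordinal im)).
    by apply: contraNT ik => iS; rewrite -(uS _ _ _ iS kS).
  (* Positions up to the missing piece [k] connect to the first end, later ones to the second. *)
  have [jk | kj] := leqP j.+1 k.
    exists (ends e).1; rewrite -[RHS]/(d e 0).
    by apply: (@line_constant (d e) 0 k) => // i ik; apply: dS'; have := ltn_ord k; lia.
  exists (ends e).2; rewrite -ep_pos_end -[RHS]/(d e m).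
  have dk i : k < i <= m -> d e i = d e k.+1.
    by apply: (@line_constant (d e) k.+1 m) => i' ik; apply: dS'; lia.
  by rewrite !dk // ?kj ?jm // ltn_ord leqnn.
by move=> x y; have [u ->] := cG x; have [v ->] := cG y.
Qed.

(** Deleting a piece of [e] removes [e] from [ep_full S]. If [e] was intact, this tests minimality
    there; otherwise a second piece of [e] goes missing and connectivity fails. *)
Lemma ep_spanning_treeP S :
  reflect ((forall e k k', (e, k) \notin S -> (e, k') \notin S -> k = k') /\
           spanning_tree (ep_full S))
          (spanning_tree S).
Proof.
have full_rem e k : ep_full (S :\ (e, k)) = ep_full S :\ e.
  apply/setP => e'; rewrite !inE; apply/forallP/andP => [eS | [ee' /forallP eS] k'].
    split; last by apply/forallP => k'; have := eS k'; rewrite inE => /andP[].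
    by apply/eqP => ee; have := eS k; rewrite ee !inE eqxx.
  by rewrite !inE xpair_eqE (negbTE ee') eS.
apply: (iffP (spanning_treeP _)).
  case=> /ep_connectedP[uS conF] minS; split=> //; apply/spanning_treeP; split=> // e.
  rewrite inE => /forallP eS; pose o := Ordinal m_gt0.
  apply: contraNN (minS _ (eS o)) => conFe; apply/ep_connectedP.
  rewrite full_rem; split=> // e' k k'; rewrite !in_setD1 !xpair_eqE.
  have [-> | _ /=] := eqVneq e' e; last exact: uS.
  by rewrite !eS !andbT !negbK => /eqP-> /eqP->.
case=> uS /spanning_treeP[conF minF]; split=> [|[e k] kS]; first exact/ep_connectedP.
apply/negP => /ep_connectedP[uS']; rewrite full_rem; apply/negP/minF.
rewrite inE; apply/forallP => k'; apply: contraTT (kS) => k'S.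
by rewrite -(uS' e k' k) ?inE ?eqxx ?negb_and ?k'S ?orbT.
Qed.

(* [g e] is the deleted piece of [e], if any. *)
Definition ep_delete (g : {ffun edge G -> option 'I_m}) : {set edge P} :=
  [set x : edge P | g x.1 != Some x.2].

Lemma ep_full_delete g : ep_full (ep_delete g) = [set e | g e == None].
Proof.
apply/setP => e; rewrite !inE; apply/forallP/eqP => [gS | gN k]; last by rewrite inE gN.
by case ge: (g e) => [k|//]; have := gS k; rewrite inE ge eqxx.
Qed.

Lemma ep_delete_inj : injective ep_delete.
Proof.
move=> g g' /setP eqg; apply/ffunP => e.
case ge: (g e) => [k|].
  by have := eqg (e, k); rewrite !inE ge eqxx => /esym/negbFE/eqP.
by case ge': (g' e) => [k|//]; have := eqg (e, k); rewrite !inE ge' ge eqxx.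
Qed.

Definition ep_deleted S : {ffun edge G -> option 'I_m} :=
  [ffun e => [pick k | (e, k) \notin S]].

Lemma ep_deletedK S :
  (forall e k k', (e, k) \notin S -> (e, k') \notin S -> k = k') ->
  ep_delete (ep_deleted S) = S.
Proof.
move=> uS; apply/setP => -[e k]; rewrite inE ffunE /=.
case: pickP => [k' k'S | allS]; last exact/esym/negbFE/allS.
apply/idP/idP => [|kS]; last by apply: contraNneq k'S => -[->].
by apply: contraNT => kS; rewrite (uS _ _ _ k'S kS).
Qed.

Lemma ep_spanning_tree_delete g :
  spanning_tree (ep_delete g) = spanning_tree [set e | g e == None].
Proof.
rewrite -ep_full_delete; apply/ep_spanning_treeP/idP => [[]// | treeF]; split=> //.
by move=> e k k'; rewrite !inE !negbK /= => /eqP-> /eqP[].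
Qed.

Lemma tau_edge_path b :
  (forall F, spanning_tree F -> #|~: F| = b) -> tau P = tau G * m ^ b.
Proof.
move=> bG.
pose D := [set g : {ffun edge G -> option 'I_m} | spanning_tree [set e | g e == None]].
have -> : tau P = #|ep_delete @: D|.
  apply: eq_card => S; rewrite inE; apply/idP/imsetP => [treeS | [g + ->]].
    have /ep_spanning_treeP[uS _] := treeS.
    exists (ep_deleted S); rewrite ?ep_deletedK //.
    by rewrite inE -ep_spanning_tree_delete ep_deletedK.
  by rewrite inE ep_spanning_tree_delete.
rewrite (card_imset _ ep_delete_inj) -sum1_card.
(* The choices [g] are grouped by the set [F] of intact edges. *)
rewrite (partition_big (fun g : {ffun edge G -> option 'I_m} => [set e | g e == None])
  (fun F => spanning_tree F)) /=; last by move=> g; rewrite inE.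
rewrite /tau -sum1dep_card big_distrl /=; apply: eq_bigr => F treeF.
rewrite mul1n sum1dep_card -(bG F treeF) -[m in RHS]card_ord.
(* For fixed [F], the admissible [g] are the functions equal to [None] on [F] and different from
   [None] off [F], with [m] values for each edge off [F]. *)
have -> : #|'I_m| = #|predC1 (None : option 'I_m)|.
  by rewrite cardC1 card_option.
rewrite -(card_pffun_on None); apply: eq_card => g; rewrite inE.
apply/andP/pffun_onP => [[gD /eqP <-] | [gF gR]].
  split; first by apply/subsetP => e; rewrite !inE.
  by move=> y /mapP[e]; rewrite mem_enum !inE => ? ->.
have gE : [set e | g e == None] = F.
  apply/setP => e; rewrite inE; apply/idP/idP => [/eqP ge | eF].
    apply: contraT => eF; suff /gR : g e \in [seq g x | x in ~: F] by rewrite ge.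
    by apply/mapP; exists e; rewrite ?mem_enum ?inE.
  apply: contraT => ge; suff /(subsetP gF) : e \in None.-support g by rewrite inE eF.
  by rewrite inE.
by rewrite inE gE eqxx.
Qed.

(** Each edge outside [ep_full S] has exactly one missing piece, so projecting missing pieces to
    their edges is injective. *)
Lemma card_edge_path_spanning_tree b :
  (forall F, spanning_tree F -> #|~: F| = b) ->
  forall S, spanning_tree S -> #|~: S| = b.
Proof.
move=> bG S /ep_spanning_treeP[uS /bG <-].
have -> : ~: ep_full S = [set x.1 | x in ~: S].
  apply/setP => e; rewrite !inE negb_forall.
  apply/existsP/imsetP => [[k kS] | [[e' k] kS ->]].
    by exists (e, k); rewrite ?inE.
  by exists k; rewrite inE in kS.
rewrite card_in_imset // => -[e k] [e' k']; rewrite !inE /= => kS k'S ee.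
by rewrite -ee in k'S *; rewrite (uS _ _ _ kS k'S).
Qed.

End EdgePath.

(** * The recursion along the self-similar graphs and its closed form *)

Section SelfSimilar.
Variables n m : nat.
Hypotheses (n_gt0 : 0 < n) (m_gt0 : 0 < m).

(** The initial cycle omits one edge, which is [nbV m n 0]; subdividing adds no omission, and
    attaching cycles adds one per old vertex. *)
Lemma card_ssgraph_spanning_tree i (S : {set edge (ssgraph i m n)}) :
  spanning_tree S -> #|~: S| = \sum_(j < i.+1) nbV m n j.
Proof.
elim: i S => [|i IHi] S treeS.
  by rewrite big_ord1 /nbV card_unit (card_cycle_spanning_tree n_gt0 treeS).
rewrite big_ord_recr /=.
apply: (card_attach_cycles_spanning_tree n_gt0 _ treeS).
exact: card_edge_path_spanning_tree.
Qed.

Lemma tau_ssgraphS i :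
  tau (ssgraph i.+1 m n) =
    tau (ssgraph i m n) * m ^ (\sum_(j < i.+1) nbV m n j) * n ^ nbV m n i.+1.
Proof.
by rewrite tau_attach_cycles // (tau_edge_path m_gt0 (@card_ssgraph_spanning_tree i)).
Qed.

End SelfSimilar.

Theorem theorem1 (n m : nat) (hn : 3 <= n) (hm : 2 <= m) (i : nat) :
  tau (ssgraph i m n) =
    n ^ (\sum_(j < i.+1) nbV m n j) * m ^ (\sum_(j < i.+1) (i - j) * nbV m n j).
Proof.
have n_gt0 : 0 < n by apply: ltn_trans hn.
have m_gt0 : 0 < m by apply: ltn_trans hm.
elim: i => [|i IHi].
  by rewrite !big_ord1 tau_cycle // /nbV card_unit subnn mul0n muln1 expn1.
rewrite tau_ssgraphS // IHi [\sum_(j < i.+2) nbV m n j]big_ord_recr /= expnD.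
rewrite [\sum_(j < i.+2) _]big_ord_recr /= subnn mul0n addn0.
(* The new index [i.+1] has weight 0, and every older weight grows by one, matching the factor from
   the last subdivision. *)
have -> : \sum_(j < i.+1) (i.+1 - j) * nbV m n j =
    \sum_(j < i.+1) (i - j) * nbV m n j + \sum_(j < i.+1) nbV m n j.
  rewrite -big_split; apply: eq_bigr => j _ /=.
  by rewrite subSn ?mulSn 1?addnC // -ltnS.
by rewrite expnD -!mulnA; congr (_ * _); rewrite [RHS]mulnC mulnA.
Qed.
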